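(* Let $q=6m$ where $m$ is a positive odd integer. Then $N(4,q,1)=\dfrac{q^2(q+2)}{4}$.
   Context: $B_q=\{0,\dots,q-1\}$ and $B_q^4$ is the set of words of length 4 over $B_q$. $N(4,q,1)$ is the maximum cardinality of a code $C\subseteq B_q^4$ capable of correcting single deletions, i.e. such that the sets $\lfloor x\rfloor_1$ ($x\in C$) of words obtained from $x$ by deleting one letter are pairwise disjoint (equivalently, the minimum deletion–insertion distance between distinct codewords exceeds 2). *)

(* Defs.v *)
From mathcomp Require Import all_boot.
Set Implicit Arguments. Unset Strict Implicit. Unset Printing Implicit Defensive.

Definition del_at (T : Type) (i : nat) (s : seq T) : seq T :=
  take i s ++ drop i.+1 s.

Definition del_ball (q n : nat) (x : n.+1.-tuple 'I_q) : {set n.-tuple 'I_q} :=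
  [set y : n.-tuple 'I_q | [exists i : 'I_n.+1, val y == del_at i (val x)]].

Definition single_del_code (q n : nat) (C : {set n.+1.-tuple 'I_q}) : Prop :=
  forall x y, x \in C -> y \in C -> x != y ->
    [disjoint del_ball x & del_ball y].

(* "N(n+1,q,1) = v": v is the maximum cardinality of a single-deletion
   correcting code in B_q^(n+1). *)
Definition is_N1 (q n v : nat) : Prop :=
  (exists C : {set n.+1.-tuple 'I_q}, single_del_code C /\ #|C| = v) /\
  (forall C : {set n.+1.-tuple 'I_q}, single_del_code C -> #|C| <= v).

(* Main.v *)
Require Import Defs.
From mathcomp Require Import all_boot.
From mathcomp Require Import zify.
Set Implicit Arguments. Unset Strict Implicit. Unset Printing Implicit Defensive.

(** Upper bound, [q] even. Give a word [abc] the weight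
    [(1 + [a = b]) (1 + [b = c])], so that all words together weigh
    [q (q + 1)^2]. Every deletion ball weighs at least [4], and at least [4 + s]
    if for [s] letters [w] it contains an odd number of words [wzw] with
    [z <> w]. For each [w] there are [q - 1] such words, an odd number, so some
    ball meets them in an odd number or one of them is uncovered. Each letter
    thus wastes one unit of weight, and [4 |C| + q <= q (q + 1)^2].

    Construction, [q = 2 h] with [h] odd. A word of length 4 over [Z/q] is given
    by its first letter and its successive differences [(a, b, c)]; its
    deletions have differences [(a, b)], [(b, c)], [(a + b, c)], [(a, b + c)].
    Take all first letters and the differences
    - [(0, b, 0)];
    - [(u, -t, u)] and [(-u, t, -u)] for [0 < t < u < h], which cover the pairs of
      nonzero residues, other than [h], of distinct absolute values;
    - [(d, h, h - d)] for [d <> 0] even, which cover the pairs [(e, -e)];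
    - [(d, h, h + d)] for [d <> h] odd, which cover the pairs [(e, e)].
    The last two families also share out the pairs [(d, h)] and [(h, d)], and
    only [(h, h)] is never covered. *)

(** * Upper bound: weights of deletion balls *)

Definition weight (T : eqType) (s : seq T) : nat :=
  if s is [:: a; b; c] then (1 + (a == b)) * (1 + (b == c)) else 0.

Definition sandwich (T : eqType) (w : T) (s : seq T) : bool :=
  if s is [:: a; b; c] then [&& a == w, c == w & b != w] else false.

Lemma sandwichE (T : eqType) (w x y z : T) :
  sandwich w [:: x; y; z] = ((x == z) && (y != x)) * (x == w) :> nat.
Proof.
rewrite /= (eq_sym x z).
by case: (eqVneq x w) => [->|_]; rewrite ?muln1 ?muln0.
Qed.

Lemma sum_3tuple (T : finType) (F : 3.-tuple T -> nat) :
  \sum_y F y = \sum_a \sum_b \sum_c F [tuple a; b; c].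
Proof.
rewrite (reindex (fun p : (T * T) * T => [tuple p.1.1; p.1.2; p.2])) /=;
  last first.
  exists (fun y : 3.-tuple T =>
    (tnth y ord0, tnth y (inord 1), tnth y (inord 2))).
    by case=> [[a b] c] _; rewrite !(tnth_nth a) /= !inordK.
  case/tupleP=> a y _; case/tupleP: y => b y; case/tupleP: y => c y.
  by rewrite (tuple0 y); apply/val_inj; rewrite /= !(tnth_nth a) /= !inordK.
rewrite pair_big pair_big /=.
by apply: eq_bigr => [[[a b] c]].
Qed.

Lemma sum_1Deq (T : finType) (b : T) : \sum_a (1 + (a == b)) = #|T| + 1.
Proof.
rewrite big_split /= sum1_card; congr (_ + _).
rewrite (bigD1 b) //= eqxx big1 // => a /negPf -> //.
Qed.

Lemma sum_weight (T : finType) :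
  \sum_(y : 3.-tuple T) weight y = #|T| * (#|T| + 1) ^ 2.
Proof.
rewrite sum_3tuple exchange_big /= -sum_nat_const.
apply: eq_bigr => b _.
under eq_bigr => a _ do rewrite -big_distrr /=.
rewrite -big_distrl /= sum_1Deq -mulnn; congr (_ * _).
by rewrite -(sum_1Deq b); apply: eq_bigr => c _; rewrite eq_sym.
Qed.

Lemma sum_sandwich (T : finType) (w : T) :
  \sum_(y : 3.-tuple T) sandwich w y = #|T| - 1.
Proof.
rewrite sum_3tuple (bigD1 w) //= [X in _ + X]big1 ?addn0; last first.
  by move=> a /negPf aw; apply: big1 => b _; apply: big1 => c _; rewrite aw.
have <- : \sum_(b : T) (b != w) = #|T| - 1.
  by rewrite -big_mkcond /= sum1_card subn1 -(cardC1 w); apply: eq_card => x.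
apply: eq_bigr => b _; rewrite (bigD1 w) //= !eqxx big1 ?addn0 //.
by move=> c /negPf ->.
Qed.

(** Two deletions agree only inside a run of equal letters; the factors keep one word per run. *)
Lemma sum_del_ball (q : nat) (F : 3.-tuple 'I_q -> nat) (a b c d : 'I_q) :
  \sum_(y in del_ball [tuple a; b; c; d]) F y =
  F [tuple b; c; d] + (a != b) * F [tuple a; c; d]
  + (b != c) * F [tuple a; b; d] + (c != d) * F [tuple a; b; c].
Proof.
set L := [:: [tuple b; c; d]; [tuple a; c; d]; [tuple a; b; d]; [tuple a; b; c]].
have E : del_ball [tuple a; b; c; d] =i undup L.
  move=> y; rewrite mem_undup !inE.
  apply/existsP/idP.
    by case; case=> [] [|[|[|[|//]]]] ? /= /eqP H; apply/or4P;
      [constructor 1|constructor 2|constructor 3|constructor 4];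
      rewrite -val_eqE /= H.
  case/or4P => /eqP ->.
  - by exists (@Ordinal 4 0 isT).
  - by exists (@Ordinal 4 1 isT).
  - by exists (@Ordinal 4 2 isT).
  - by exists (@Ordinal 4 3 isT).
have eq3 (x y z x' y' z' : 'I_q) :
  ([tuple x; y; z] == [tuple x'; y'; z']) = [&& x == x', y == y' & z == z'].
  by rewrite -val_eqE /= !eqseq_cons andbT.
rewrite (eq_bigl _ _ E) -big_uniq ?undup_uniq //= !inE !eq3 {L E}.
have [?|/negPf ab] := eqVneq a b; have [?|/negPf bc] := eqVneq b c;
  have [?|/negPf cd] := eqVneq c d; subst.
all: rewrite ?eqxx ?ab ?bc ?cd ?andbF ?andbT /=.
all: by rewrite ?big_cons ?big_nil ?mul1n ?mul0n ?addn0 ?addnA.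
Qed.

Lemma odd_sandwich_weight (q : nat) (x : 4.-tuple 'I_q) :
  \sum_w odd (\sum_(y in del_ball x) sandwich w y) + 4
  <= \sum_(y in del_ball x) weight y.
Proof.
case/tupleP: x => a x; case/tupleP: x => b x; case/tupleP: x => c x.
case/tupleP: x => d x; rewrite (tuple0 x) {x} sum_del_ball /=.
(* Words [wzw] in the ball have [w = b] for the first deletion ([eb]), and [w = a] for the other
   three ([ea]). *)
pose eb : nat := (b == d) && (c != b).
pose ea := (a != b) * ((a == d) && (c != a)) + (b != c) * ((a == d) && (b != a))
  + (c != d) * ((a == c) && (b != a)).
have sum_delta (e : bool) (z : 'I_q) : \sum_w e * (z == w) = e.
  rewrite (bigD1 z) //= eqxx muln1 big1 ?addn0 // => w.
  by rewrite eq_sym => /negPf ->; rewrite muln0.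
apply: (@leq_trans (odd eb + odd ea + 4)).
  rewrite leq_add2r -(sum_delta (odd eb) b) -(sum_delta (odd ea) a) -big_split /=.
  apply: leq_sum => w _; rewrite sum_del_ball.
  set n := (X in odd X).
  have -> : n = eb * (b == w) + ea * (a == w).
    by rewrite /n !sandwichE /ea !mulnDl !mulnA !addnA.
  rewrite oddD; case: (b == w); case: (a == w); rewrite ?muln0 ?muln1;
    by case: (odd eb); case: (odd ea).
rewrite {sum_delta}/eb {eb}/ea {ea}.
repeat (case: eqVneq => [?|?]; subst; rewrite ?eqxx //=).
Qed.

Lemma code_card_bound (q : nat) (C : {set 4.-tuple 'I_q}) :
  0 < q -> ~~ odd q -> single_del_code C -> 4 * #|C| + q <= q * (q + 1) ^ 2.
Proof.
move=> q_gt0 q_even codeC.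
pose cov (y : 3.-tuple 'I_q) := \sum_(x in C) (y \in del_ball x).
(* Hence [1 - cov y] is the indicator of an uncovered word. *)
have cov_le1 y : cov y <= 1.
  rewrite /cov -big_mkcondr sum1_card; apply/card_le1_eqP => x x'.
  move=> /andP[xC yx] /andP[x'C yx']; apply/eqP; rewrite eq_sym;
  apply: contraTT yx' => xx'.
  by rewrite (disjointFr (codeC _ _ xC x'C xx') yx).
have cov_split (F : 3.-tuple 'I_q -> nat) :
  \sum_(x in C) \sum_(y in del_ball x) F y + \sum_y (1 - cov y) * F y
  = \sum_y F y.
  have -> : \sum_(x in C) \sum_(y in del_ball x) F y = \sum_y cov y * F y.
    under eq_bigr => x _ do rewrite big_mkcond /=.
    rewrite exchange_big /=; apply: eq_bigr => y _.
    rewrite /cov big_distrl /=; apply: eq_bigr => x _.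
    by case: (y \in _); rewrite ?mul1n.
  rewrite -big_split /=; apply: eq_bigr => y _.
  by rewrite -mulnDl subnKC ?mul1n.
have sand w : 1 <= \sum_(x in C) odd (\sum_(y in del_ball x) sandwich w y)
                + \sum_y (1 - cov y) * sandwich w y.
  rewrite lt0n addn_eq0; apply/negP => /andP[/eqP/eqP].
  rewrite sum_nat_eq0 => /forall_inP even0 /eqP unc0.
  have := cov_split (fun y => sandwich w y).
  rewrite unc0 addn0 sum_sandwich card_ord.
  move=> /(congr1 odd); rewrite (big_morph odd oddD (erefl _)) big1.
    by move=> E; lia.
  by move=> x /even0; case: odd.
have := cov_split (fun y => weight y); rewrite sum_weight card_ord => <-.
have le_q :
  q <= \sum_(x in C) \sum_w odd (\sum_(y in del_ball x) sandwich w y)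
       + \sum_(y : 3.-tuple 'I_q) \sum_w (1 - cov y) * sandwich w y.
  rewrite exchange_big [X in _ + X]exchange_big -big_split /=.
  rewrite -[X in X <= _](card_ord q) -sum1_card.
  by apply: leq_sum => w _; apply: sand.
have le1 : \sum_(x in C) (\sum_w odd (\sum_(y in del_ball x) sandwich w y) + 4)
   <= \sum_(x in C) \sum_(y in del_ball x) weight y.
  by apply: leq_sum => x _; apply: odd_sandwich_weight.
(* Weights are positive, and a word is [wzw] for at most one [w]. *)
have le2 : \sum_(y : 3.-tuple 'I_q) \sum_w (1 - cov y) * sandwich w y
   <= \sum_y (1 - cov y) * weight y.
  apply: leq_sum => y _; rewrite -big_distrr leq_mul2l; apply/orP; right.
  case/tupleP: y => a y; case/tupleP: y => b y; case/tupleP: y => c y.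
  rewrite (tuple0 y) /= (bigD1 a) //= big1.
    by rewrite addn0 (leq_trans (leq_b1 _)) // muln_gt0.
  by move=> w; rewrite eq_sym => /negPf ->.
apply: leq_trans (leq_add le1 le2).
by rewrite big_split /= sum_nat_const addnAC [leqRHS]addnC [4 * _]mulnC leq_add2l.
Qed.

(** * Construction: codes from successive differences *)

Section DifferenceCode.

Variable h : nat.
Notation q := (h + h).

Definition addq (a b : nat) := if a + b < q then a + b else a + b - q.
Definition subq (a b : nat) := if b <= a then a - b else a + q - b.

(* The first two differences of the words, indexed by ['I_h * 'I_h.+1], whose
   size [h * h.+1] is the number of words per first letter. The two triangles
   [j <= i] and [i < j] give the two signs, with [(u, t) = (i.+1, j)] and
   [(u, t) = (j, i)]; [t = 0] stands for the difference [h] and [u = h] for the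
   family [(0, b, 0)]. *)
Definition diff12 (i j : nat) : nat * nat :=
  if j <= i then
    (if i.+1 == h then (0, j) else (i.+1, if j == 0 then h else q - j))
  else
    (if j == h then (0, i + h) else (q - j, if i == 0 then h else i)).

Definition diff3 (a b : nat) : nat :=
  if a == 0 then 0
  else if b == h then (if odd a then addq a h else subq h a)
  else a.

(* Sends the differences of a covered word of length 3 to the first two
   differences of the codeword covering it, and to the amount by which its first
   letter exceeds that of the codeword. *)
Definition canon (a b : nat) : nat * nat * nat :=
  if (a == 0) || (b == 0) then (0, a + b, 0)
  else if b == h then (a, h, 0)
  else if a == h then
    let d := if odd b then subq h b else addq b h in (d, h, d)
  else if a == b then (if odd a then a else addq a h, h, 0)
  else if a + b == q then (if odd a then addq a h else a, h, 0)
  else if (a < h) != (b < h) then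
    (if (a < h) == (q < a + b) then (a, b, 0) else (b, a, b))
  else if a < h then (maxn a b, q - maxn a b + minn a b, 0)
  else (minn a b, maxn a b - minn a b, 0).

Lemma diff12_inj i j i' j' : i < h -> j <= h -> i' < h -> j' <= h ->
  diff12 i j = diff12 i' j' -> i = i' /\ j = j'.
Proof.
rewrite /diff12 => ? ? ? ?.
by repeat case: ifPn => ?; move=> E; have /= := congr1 fst E;
  have /= := congr1 snd E; lia.
Qed.

Lemma diff12_lt i j : i < h -> j <= h ->
  (diff12 i j).1 < q /\ (diff12 i j).2 < q.
Proof. by rewrite /diff12 => ? ?; repeat case: ifPn => ? /=; lia. Qed.

Lemma diff3_lt a b : a < q -> diff3 a b < q.
Proof. by rewrite /diff3 /addq /subq => ?; repeat case: ifPn => ?; lia. Qed.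

(** For odd [h], [d] and [h - d] (or [h + d]) have opposite parities, which lets [canon] tell the
    two families with middle difference [h] apart. *)
Lemma canon_diff i j : odd h -> i < h -> j <= h ->
  let: (a, b) := diff12 i j in let c := diff3 a b in
  [/\ canon a b = (a, b, 0), canon b c = (a, b, a),
      canon (addq a b) c = (a, b, 0) & canon a (addq b c) = (a, b, 0)].
Proof.
move=> ? ? ?; rewrite /diff12.
repeat case: ifPn => ?; rewrite /= /diff3 /=; repeat case: ifPn => ?;
  try (exfalso; lia); rewrite /addq /subq ?addn0 /=;
  repeat (case: ifPn => ?; try (exfalso; lia)); split.
all: rewrite /canon /addq /subq /= ?addn0;
  repeat (case: ifPn => ?; try (exfalso; lia)).
all: by congr (_, _, _); lia.
Qed.

Definition word (x i j : nat) : seq nat :=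
  let: (a, b) := diff12 i j in
  let y := addq x a in let z := addq y b in [:: x; y; z; addq z (diff3 a b)].

Definition decode (s : seq nat) : nat * nat * nat :=
  if s is [:: x; y; z] then
    let: (a, b, off) := canon (subq y x) (subq z y) in (subq x off, a, b)
  else (0, 0, 0).

Lemma addq_lt a b : a < q -> b < q -> addq a b < q.
Proof. by rewrite /addq; case: ifPn; lia. Qed.

Lemma addqK x a : x < q -> a < q -> subq (addq x a) x = a.
Proof.
by move=> ? ?; rewrite /addq; case: ifPn => ?; rewrite /subq; case: ifPn => ?; lia.
Qed.

Lemma addqA x a b : x < q -> a < q -> b < q ->
  addq (addq x a) b = addq x (addq a b).
Proof. move=> ? ? ?; rewrite {2 4}/addq; case: ifPn => ?; case: ifPn => ?;
by rewrite /addq; case: ifPn => ?; case: ifPn => ?; lia. Qed.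

Lemma subqK x a : x < q -> a < q -> subq (addq x a) a = x.
Proof.
by move=> ? ?; rewrite /addq; case: ifPn => ?; rewrite /subq; case: ifPn => ?; lia.
Qed.

Lemma word_lt x i j : x < q -> i < h -> j <= h ->
  all (fun y => y < q) (word x i j).
Proof.
move=> xq ih jh; rewrite /word; have := diff12_lt ih jh.
case: (diff12 i j) => a b /= [aq bq].
by rewrite xq !addq_lt // diff3_lt.
Qed.

(** Deleting an end letter drops a difference and deleting an inner one merges two: these are the
    four clauses of [canon_diff]. *)
Lemma decode_del_word x i j k : odd h -> x < q -> i < h -> j <= h -> k < 4 ->
  decode (del_at k (word x i j)) = (x, (diff12 i j).1, (diff12 i j).2).
Proof.
move=> h_odd xq ih jh; rewrite /word.
have := diff12_lt ih jh; have := canon_diff h_odd ih jh.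
case: (diff12 i j) => a b /= [E3 E0 E1 E2] [aq bq].
have cq := diff3_lt b aq; set c := diff3 a b in E3 E0 E1 E2 cq *.
have yq := addq_lt xq aq; have zq := addq_lt yq bq.
have abq := addq_lt aq bq; have bcq := addq_lt bq cq.
have s0 : subq x 0 = x by rewrite /subq subn0.
case: k => [|[|[|[|//]]]] _; rewrite /del_at /=.
- by rewrite !addqK // E0 subqK.
- by rewrite [in subq _ x]addqA // !addqK // E1 s0.
- by rewrite [addq _ c]addqA // !addqK // E2 s0.
- by rewrite !addqK // E3 s0.
Qed.

Definition codeword (p : 'I_q * ('I_h * 'I_h.+1)) : 4.-tuple 'I_q :=
  [tuple insubd p.1 (nth 0 (word p.1 p.2.1 p.2.2) k) | k < 4].

Lemma val_codeword p : map val (codeword p) = word p.1 p.2.1 p.2.2.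
Proof.
case: p => x [i j]; rewrite [RHS]/=.
have /all_nthP lt_w := word_lt (ltn_ord x) (ltn_ord i) (ltn_ord j : j <= h).
have sz : size (word x i j) = 4 by rewrite /word; case: diff12.
apply: (@eq_from_nth _ 0); first by rewrite size_map (size_tuple (codeword _)) sz.
rewrite size_map (size_tuple (codeword _)) => k k4.
rewrite (nth_map x) ?(size_tuple (codeword _)) //.
rewrite -(tnth_nth x (codeword _) (Ordinal k4)).
by rewrite tnth_mktuple val_insubd /= lt_w ?sz.
Qed.

Lemma codeword_del_inj p p' (k k' : 'I_4) : odd h ->
  del_at k (codeword p) = del_at k' (codeword p') -> p = p'.
Proof.
move=> h_odd /(congr1 (map val)).
rewrite /del_at !map_cat !map_take !map_drop !val_codeword -!/(del_at _ _).
move=> /(congr1 decode); case: p p' => x [i j] [x' [i' j']].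
have le_h (l : 'I_h.+1) : l <= h := ltn_ord l.
rewrite !decode_del_word ?le_h //= => -[xx' E1 E2].
have [|ii' jj'] := diff12_inj (ltn_ord i) (le_h j) (ltn_ord i') (le_h j').
  by rewrite [LHS]surjective_pairing [RHS]surjective_pairing E1 E2.
by congr (_, (_, _)); apply: val_inj.
Qed.

Lemma codeword_code : odd h ->
  single_del_code [set codeword p | p : 'I_q * ('I_h * 'I_h.+1)].
Proof.
move=> h_odd _ _ /imsetP[p _ ->] /imsetP[p' _ ->].
apply: contraR; rewrite -setI_eq0 => /set0Pn[y].
rewrite !inE => /andP[/existsP[k /eqP yk] /existsP[k' /eqP yk']].
by rewrite (codeword_del_inj h_odd (etrans (esym yk) yk')).
Qed.

Lemma card_code : odd h ->
  #|[set codeword p | p : 'I_q * ('I_h * 'I_h.+1)]| = q * (h * h.+1).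
Proof.
move=> h_odd; rewrite card_imset ?card_prod ?card_ord // => p p' E.
(* Equal codewords have equal first deletions. *)
by apply: (@codeword_del_inj p p' ord0 ord0); rewrite ?E.
Qed.

End DifferenceCode.

(* N(4,q,1) = q^2 (q+2)/4 for q = 6m, m odd positive.  (Words of length 4 = 3.+1.) *)
Theorem theorem4p1 (m : nat) (hm : 0 < m) (hodd : odd m) :
  is_N1 (6 * m) 3 ((6 * m) ^ 2 * (6 * m + 2) %/ 4).
Proof.
have h_odd : odd (3 * m) by rewrite oddM hodd.
have h_gt0 : 0 < 3 * m by rewrite muln_gt0 hm.
have -> : 6 * m = 3 * m + 3 * m by rewrite -mulnDl.
move: (3 * m) h_odd h_gt0 => h h_odd h_gt0.
have -> : (h + h) ^ 2 * (h + h + 2) %/ 4 = (h + h) * (h * h.+1).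
  have -> : (h + h) ^ 2 * (h + h + 2) = (h + h) * (h * h.+1) * 4 by lia.
  by rewrite mulnK.
split; first by exists [set codeword p | p : 'I_(h + h) * ('I_h * 'I_h.+1)];
  split; [exact: codeword_code | exact: card_code].
move=> C codeC.
have q_gt0 : 0 < h + h by rewrite addn_gt0 h_gt0.
have q_even : ~~ odd (h + h) by rewrite oddD addbb.
have := code_card_bound q_gt0 q_even codeC.
(* With [q = h + h], [q * (q + 1) ^ 2 - q] equals [q ^ 2 * (q + 2)]. *)
by move: #|C| => n; lia.
Qed.
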